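(* For any $A,B\subseteq\mathbb N$, the following are equivalent. (1) $A\leq_{\mathrm{fe}}B$. (2) The family $\{B-a:a\in A\}$ has the finite intersection property. (3) There exists an ultrafilter $\mathcal V$ on $\mathbb N$ such that $A$ is a subset of the leftward $\mathcal V$-shift of $B$, namely $B-\mathcal V=\{x\in\mathbb N:B-x\in\mathcal V\}$. (4) There exists an ultrafilter $\mathcal V$ on $\mathbb N$ such that $A=B'-\mathcal V$ for some subset $B'$ of $B$. (5) The basic open sets $\overline A$ and $\overline B$ in the Stone-Čech compactification $\beta\mathbb N$ satisfy $\overline A+\mathcal V\subseteq\overline B$ for some ultrafilter $\mathcal V\in\beta\mathbb N$. (6) Some superset of $A$ (in $\mathcal P(\mathbb N)$) is in the topological closure, in the power set $\mathcal P(\mathbb N)$, of the set of leftward shifts $\{B-k:k\in\mathbb N\}$ of $B$. (7) There is a subset $B'$ of $B$ such that $A$ is in the topological closure, in $\mathcal P(\mathbb N)$, of the set of leftward shifts $\{B'-k:k\in\mathbb N\}$ of $B'$.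
   Context: $\mathbb N$ contains $0$. For $A\subseteq\mathbb N$ and $k\in\mathbb N$: $A+k=\{a+k:a\in A\}$ and $A-k=\{x\in\mathbb N:x+k\in A\}$. For $A,B\subseteq\mathbb N$, $A\leq_{\mathrm{fe}}B$ ($A$ is finitely embeddable in $B$) means that for each finite $F\subseteq A$ there is $k\in\mathbb N$ with $F+k\subseteq B$. For $X\subseteq\mathbb N$ and an ultrafilter $\mathcal V$ on $\mathbb N$, the leftward $\mathcal V$-shift of $X$ is $X-\mathcal V=\{x\in\mathbb N:X-x\in\mathcal V\}$. $\beta\mathbb N$ is identified with the set of all ultrafilters on $\mathbb N$ (principal ones included, identified with natural numbers), with basic open sets $\overline A=\{\mathcal U\in\beta\mathbb N:A\in\mathcal U\}$. Addition on $\beta\mathbb N$ is $\mathcal U+\mathcal V=\{X\subseteq\mathbb N:\{k\in\mathbb N:X-k\in\mathcal V\}\in\mathcal U\}$, and $\overline A+\mathcal V=\{\mathcal U+\mathcal V:\mathcal U\in\overline A\}$. The power set $\mathcal P(\mathbb N)$ carries the product topology of $\{0,1\}^{\mathbb N}$ ($\{0,1\}$ discrete) via characteristic functions. *)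

(* Defs.v *)
From HB Require Import structures.
From mathcomp Require Import all_boot.
From mathcomp Require Import all_classical topology.

Set Implicit Arguments.
Unset Strict Implicit.
Unset Printing Implicit Defensive.

Local Open Scope classical_set_scope.

Definition translate (A : set nat) (k : nat) : set nat := [set a + k | a in A].

Definition leftshift (A : set nat) (k : nat) : set nat := [set x | A (x + k)].

Definition finitely_embeddable (A B : set nat) : Prop :=
  forall F : set nat, finite_set F -> F `<=` A ->
    exists k : nat, translate F k `<=` B.

(* The points of the Stone-Cech compactification of nat: all ultrafilters,
   principal ones included. *)
Record betaN := BetaN {
  beta_filter :> set nat -> Prop;
  beta_ultra : UltraFilter beta_filter }.

Definition ultrashift (X : set nat) (V : betaN) : set nat :=
  [set x | V (leftshift X x)].

Definition basic_open (A : set nat) : set betaN := [set U : betaN | U A].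

Definition beta_add_system (U V : betaN) : set_system nat :=
  [set X | U [set k | V (leftshift X k)]].

Lemma beta_add_ultra (U V : betaN) : UltraFilter (beta_add_system U V).
Proof.
have UU := beta_ultra U; have UV := beta_ultra V.
have SU X Y : X `<=` Y -> U X -> U Y by exact: (@filterS _ (beta_filter U)).
have SV X Y : X `<=` Y -> V X -> V Y by exact: (@filterS _ (beta_filter V)).
have properUV : ProperFilter (beta_add_system U V).
  split.
    rewrite /beta_add_system /= => U0.
    apply: (@filter_not_empty _ (beta_filter U) _); apply: SU U0 => k /= V0.
    by apply: (@filter_not_empty _ (beta_filter V) _); apply: SV V0.
  split.
  - apply: (SU setT); last exact: (@filterT _ (beta_filter U)).
    by move=> k _ /=; apply: (SV setT) => //; exact: (@filterT _ (beta_filter V)).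
  - move=> X Y UX UY.
    apply: SU (@filterI _ (beta_filter U) _ _ _ UX UY) => k [/= VX VY].
    exact: SV (@filterI _ (beta_filter V) _ _ _ VX VY).
  - move=> X Y XY; apply: SU => k /=.
    by apply: SV => x /=; exact: XY.
split=> // G properG sG; apply/seteqP; split=> // X GX; apply: contrapT => nUX.
have [//|UnX] := in_ultra_setVsetC [set k | V (leftshift X k)] UU.
have GnX : G (~` X).
  apply: sG; apply: SU UnX => k /= nVX.
  by have [//|] := in_ultra_setVsetC (leftshift X k) UV.
by apply: (@filter_not_empty _ G _); rewrite -(setICr X); exact: filterI.
Qed.

Definition beta_add (U V : betaN) : betaN := BetaN (beta_add_ultra U V).

Definition characteristic (A : set nat) : {ptws nat -> bool} := fun n => n \in A.

(* As [characteristic] is a bijection onto {ptws nat -> bool}, the initial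
   topology it induces is the product topology transported to subsets of nat. *)
Definition powersetN : Type := set nat.

HB.instance Definition _ :=
  Topological.copy powersetN (initial_topology characteristic).

Definition leftshifts (B : set nat) : set powersetN :=
  [set leftshift B k | k in [set: nat]].

(* Main.v *)
(* Ultrafilter shifts [B - V] are the limits of shifts [B - k] along [V], so they
   lie in the closure of those shifts; conversely a point of the closure agrees
   with some [B - k] on any given finite set.  Enlarging [A] is avoided in (4) and
   (7) by shrinking [B] to a union of far apart translates of initial segments of
   [A].  Principal ultrafilters recover [A] from the basic open set in (5). *)
Require Import Defs.
From mathcomp Require Import all_boot.
From mathcomp Require Import all_classical topology.
From mathcomp Require Import finmap zify.
Local Open Scope classical_set_scope.

(** Convergence in a product is coordinatewise, and in a discrete factor it means being eventually
    constant. *)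
Lemma cvg_powersetN (F : set_system powersetN) (X : powersetN) : Filter F ->
  F --> X <-> forall x, F [set Y : powersetN | Y x <-> X x].
Proof.
move=> FF; split=> [FX x|FX].
  have Fc : characteristic @ F --> characteristic X.
    exact: cvg_trans (cvg_app _ FX) (@initial_continuous _ _ characteristic X).
  have /discrete_cvg Fx : (characteristic ^~ x) @ F --> characteristic X x.
    exact: cvg_comp Fc (@proj_continuous _ (fun=> bool) x (characteristic X)).
  apply: (@filterS _ F _ _ _ _ Fx) => Y /= /(congr1 is_true).
  by rewrite /characteristic /in_mem /= !in_setE => ->.
move=> W [_ /= [[O oO <-]] OX /filterS]; apply.
have : characteristic @ F --> characteristic X; last first.
  by apply; exact: open_nbhs_nbhs.
apply/pointwise_cvgP => x; apply/discrete_cvg.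
apply: (@filterS _ F _ _ _ _ (FX x)) => Y /= YX; rewrite /characteristic.
by apply/idP/idP; rewrite !in_setE => /YX.
Qed.

Lemma betaS {V : betaN} {X Y : set nat} : X `<=` Y -> V X -> V Y.
Proof. by have UV := beta_ultra V; exact: filterS. Qed.

Lemma closure_leftshifts_ultrashift (B : set nat) (V : betaN) :
  closure (leftshifts B) (ultrashift B V).
Proof.
have UV := beta_ultra V.
pose G := fmap (leftshift B : nat -> powersetN) V.
have PG : ProperFilter G by exact: fmap_proper_filter.
rewrite closureEcvg; exists G => //.
split; last first.
  by move=> W sBW; apply: (@filterE _ (beta_filter V)) => k; apply: sBW; exists k.
apply/cvg_powersetN => x; rewrite /G /fmap/= /ultrashift/=.
(* Since [x + k = k + x], the shift by [k] contains [x] iff [k] lies in [leftshift B x], a set that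
   [V] decides. *)
have [VB|VnB] := in_ultra_setVsetC (leftshift B x) UV.
  by apply: betaS (VB) => k /=; rewrite /leftshift/= addnC; split.
apply: betaS (VnB) => k /=; rewrite /leftshift/= addnC => nB.
by split=> // VB; have [? []] := filter_ex (filterI VB VnB).
Qed.

Lemma closure_leftshifts_fe (A B : set nat) (X : powersetN) :
  A `<=` X -> closure (leftshifts B) X -> finitely_embeddable A B.
Proof.
move=> AX BX _ /finite_fsetP[F ->] FA.
(* Agreement with [X] on a finite set is a neighbourhood of [X]. *)
have : nbhs X (\bigcap_(x in [set` F]) [set Y : powersetN | Y x <-> X x]).
  by apply: filter_bigI => x _; exact: (cvg_powersetN (nbhs X) X _).1.
move=> /BX[_ [[k _ <-] kX]]; exists k => _ [a Fa <-].
by apply/(kX a Fa)/AX/FA.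
Qed.

Lemma fe_finI (A B : set nat) :
  finitely_embeddable A B -> finI A (fun a : nat => leftshift B a).
Proof.
move=> AB F FA; have [|k kB] := AB [set` F] (finite_fset F).
  by move=> a /FA; rewrite in_setE.
by exists k => a Fa; rewrite /leftshift/= addnC; apply: kB; exists a.
Qed.

Lemma finI_ultrashift (A B : set nat) :
  finI A (fun a : nat => leftshift B a) ->
  exists V : betaN, A `<=` ultrashift B V.
Proof.
move=> /finI_filter/ultraFilterLemma[V [UV sV]]; exists (BetaN UV) => a Aa.
by apply: sV; exists (leftshift B a) => //; exact: finI_from1.
Qed.

Lemma ultrashiftS (B' B : set nat) (V : betaN) :
  B' `<=` B -> ultrashift B' V `<=` ultrashift B V.
Proof.
by move=> B'B x; apply: betaS => k; exact: B'B.
Qed.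

(* Either one translate of [A] lies in [B] and [c] is constant, or the
   embeddings of initial segments of [A] can be chosen arbitrarily far away, and
   then for a sparse choice [x + c n] with [x <= n] can only lie in the [n]-th
   translate making up [B']. *)
Lemma fe_sequence (A B : set nat) : finitely_embeddable A B ->
  exists2 B' : set nat, B' `<=` B &
    exists c : nat -> nat, forall x, \forall n \near \oo, B' (x + c n) <-> A x.
Proof.
move=> AB; have [[k kB]|nk] := pselect (exists k, translate A k `<=` B).
  exists (translate A k) => //; exists (fun=> k) => x; apply: filterE => n.
  by split=> [[a Aa /addIn <-]//|Ax]; exists x.
have /choice[f fP] : forall k, exists a, A a /\ ~ B (a + k).
  move=> k; apply: contrapT => kB; apply: nk; exists k => _ [a Aa <-].
  by apply: contrapT => nB; apply: kB; exists a.
have /choice[g gP] : forall n, exists k, (n < k)%N /\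
    forall a, A a -> (a <= n)%N -> B (a + k).
  move=> n.
  (* Including [f 0, ..., f n] rules out every shift [k <= n], because [f k + k] is not in [B]. *)
  have [||k kB] := AB ((`I_n.+1 `&` A) `|` f @` `I_n.+1).
  - by rewrite finite_setU; split; [apply: finite_setIl|apply: finite_image].
  - by move=> _ [[]//|[i _ <-]]; case: (fP i).
  exists k; split=> [|a Aa an]; last by apply: kB; exists a => //; left.
  rewrite ltnNge; apply/negP => kn; case: (fP k) => _; apply.
  by apply: kB; exists (f k) => //; right; exists k.
(* The argument [c m + m] forces [c m.+1] beyond the whole [m]-th block; as [c m > 0], it also
   covers the elements of [A] up to [m.+1]. *)
pose fix c n := if n is m.+1 then g (c m + m) else g 0.
have c_gt0 n : (0 < c n)%N.
  by case: n => [|n] /=; [case: (gP 0)|case: (gP (c n + n)); lia].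
have cB n a : A a -> (a <= n)%N -> B (a + c n).
  case: n => [|n] Aa an; first by case: (gP 0) => _; apply.
  by case: (gP (c n + n)) => _; apply=> //; have := c_gt0 n; lia.
have c_lt m n : (m < n)%N -> (c m + m < c n)%N.
  elim: n => // n IHn; rewrite ltnS leq_eqVlt => /predU1P[->|/IHn mn].
    by case: (gP (c n + n)).
  by case: (gP (c n + n)) => /= + _; lia.
exists [set z | exists n a, [/\ A a, (a <= n)%N & z = a + c n]].
  by move=> _ [n [a [Aa an ->]]]; exact: cB.
exists c => x; exists x => // n /= xn; split=> [[m [a [Aa am]]]|Ax]; last first.
  by exists n, x.
(* The blocks [[c n, c n + n]] are disjoint, so [x + c n = a + c m] forces [m = n]. *)
have [/c_lt|/c_lt|->] := ltngtP m n; [lia|lia|].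
by move=> /addIn ->.
Qed.

Lemma fe_eq_ultrashift (A B : set nat) : finitely_embeddable A B ->
  exists V : betaN, exists2 B' : set nat, B' `<=` B & A = ultrashift B' V.
Proof.
move=> /fe_sequence[B' B'B [c cB']].
(* Any ultrafilter extending the image under [c] of the filter at infinity sees the eventual
   behaviour along [c]. *)
have [V [UV sV]] := ultraFilterLemma (fmap_proper_filter c eventually_filter).
have Vc x : V [set k | B' (x + k) <-> A x] by apply: sV; exact: cB'.
exists (BetaN UV), B' => //; apply/seteqP; split=> x.
  move=> Ax; rewrite /ultrashift/=; apply: filterS (Vc x) => k /= B'A.
  by rewrite /leftshift/= addnC; apply/B'A.
rewrite /ultrashift/= => VB'; have [k [+ [+ _]]] := filter_ex (filterI VB' (Vc x)).
by rewrite /leftshift/= addnC => B'x /(_ B'x).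
Qed.

(** By definition [B] belongs to [beta_add U V] iff [ultrashift B V] belongs to [U]. *)
Lemma beta_add_subP (A B : set nat) (V : betaN) :
  A `<=` ultrashift B V <->
  [set beta_add U V | U in basic_open A] `<=` basic_open B.
Proof.
split=> [AB _ [U UA <-]|AB a Aa].
  exact: betaS UA.
have : basic_open B (beta_add (BetaN (principal_filter_ultra a)) V).
  by apply: AB; eexists; last reflexivity; exact/principal_filterP.
by move=> /principal_filterP.
Qed.

Theorem theorem4 (A B : set nat) :
  [<-> finitely_embeddable A B;
       finI A (fun a : nat => leftshift B a);
       exists V : betaN, A `<=` ultrashift B V;
       exists V : betaN, exists2 B' : set nat, B' `<=` B & A = ultrashift B' V;
       exists V : betaN,
         [set beta_add U V | U in basic_open A] `<=` basic_open B;
       exists2 A' : set nat, A `<=` A' & closure (leftshifts B) A';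
       exists2 B' : set nat, B' `<=` B & closure (leftshifts B') A].
Proof.
tfae.
- exact: fe_finI.
- exact: finI_ultrashift.
- move=> [V AV]; apply: fe_eq_ultrashift.
  exact: closure_leftshifts_fe AV (closure_leftshifts_ultrashift B V).
- move=> [V [B' B'B ->]]; exists V.
  by apply/beta_add_subP; exact: ultrashiftS.
- move=> [V /beta_add_subP AV]; exists (ultrashift B V) => //.
  exact: closure_leftshifts_ultrashift.
- move=> [A' AA' /(closure_leftshifts_fe _ _ _ AA')/fe_eq_ultrashift].
  move=> [V [B' B'B ->]]; exists B' => //.
  exact: closure_leftshifts_ultrashift.
- move=> [B' B'B AB']; have fAB' := closure_leftshifts_fe _ _ _ (@subset_refl _ A) AB'.
  by move=> F finF /(fAB' F finF)[k kB']; exists k => z /kB'/B'B.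
Qed.
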